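(* Let $\{F_i\}_{i\in\mathbb{N}}$ be a collection of finite groups with $F_0=\{1\}$, where $\mathbb{N}=\{0,1,2,\dots\}$. Equip $G=\bigoplus_{i\in\mathbb{N}}F_i$ with the proper length function $$l(g)=\min\Big\{n\in\mathbb{N}: g\in\bigoplus_{i=0}^nF_i\Big\}.$$ Then $\alpha_2^{\#}(G)\ge\frac13$, where the equivariant compression is taken with respect to $l$.
   Context: $G$ is regarded as a discrete group. A 1-cocycle associated to a unitary representation $\pi$ of $G$ on a Hilbert space $\mathcal{H}$ is a map $b:G\to\mathcal{H}$ with $b(gh)=\pi(g)b(h)+b(g)$ for all $g,h\in G$. It is large-scale Lipschitz (with respect to $l$) if there are $C,D>0$ with $\|b(g)\|\le C\,l(g)+D$ for all $g\in G$. Its compression $R(b)$ is the supremum of the $r\in[0,1]$ for which there exist $C,D>0$ with $\frac1C\,l(g)^r-D\le\|b(g)\|\le C\,l(g)+D$ for all $g\in G$. The equivariant Hilbert space compression $\alpha_2^{\#}(G)$ is the supremum of $R(b)$ over all large-scale Lipschitz 1-cocycles of $G$ associated to unitary representations on Hilbert spaces. *)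

(* Defs.v *)
From HB Require Import structures.
From mathcomp Require Import all_boot all_order all_fingroup all_algebra.
From mathcomp Require Import sesquilinear complex.
From mathcomp Require Import all_classical all_reals all_analysis.

Set Implicit Arguments.
Unset Strict Implicit.
Unset Printing Implicit Defensive.

Import Order.TTheory GRing.Theory Num.Theory.
Import numFieldNormedType.Exports.

Local Open Scope classical_set_scope.
Local Open Scope ring_scope.
Local Open Scope complex_scope.

(* The norm takes values in [R[i]], whose order satisfies [x <= y] iff
   [Re x <= Re y] and [Im x = Im y]. *)
Record hilbertType (R : realType) := HilbertType {
  hilbert_sort :> completeNormedModType R[i];
  inner : {dot hilbert_sort for Num.conj};
  innerE : forall u : hilbert_sort, inner u u = `|u| ^+ 2
}.

Section Cocycle.
Variables (R : realType) (G : groupType) (H : hilbertType R).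

Definition unitary (u : {linear H -> H}) : Prop :=
  isometry (inner H) (inner H) u /\ bijective u.

Definition unitary_representation (pi : G -> {linear H -> H}) : Prop :=
  (forall g, unitary (pi g)) /\ (forall g h v, pi (g * h)%g v = pi g (pi h v)).

Definition cocycle (pi : G -> {linear H -> H}) (b : G -> H) : Prop :=
  forall g h, b (g * h)%g = pi g (b h) + b g.

Variable l : G -> R.

Definition large_scale_lipschitz (b : G -> H) : Prop :=
  exists C D : R, [/\ 0 < C, 0 < D & forall g, `|b g| <= (C * l g + D)%:C].

(* [0 `^ 0 = 1], while [0 `^ r = 0] for [r != 0]. *)
Definition compression_exponents (b : G -> H) : set R :=
  [set r | 0 <= r <= 1 /\
    exists C D : R, [/\ 0 < C, 0 < D & forall g,
      (C^-1 * l g `^ r - D)%:C <= `|b g| <= (C * l g + D)%:C]].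

(* For large-scale Lipschitz [b] the exponent 0 is admissible, so this is the
   supremum of a nonempty subset of [0, 1]. *)
Definition compression (b : G -> H) : R := sup (compression_exponents b).

End Cocycle.

(* The zero cocycle makes this the supremum of a nonempty subset of [0, 1]. *)
Definition equivariant_compression (R : realType) (G : groupType)
    (l : G -> R) : R :=
  sup [set c | exists (H : hilbertType R) (pi : G -> {linear H -> H})
                      (b : G -> H),
    [/\ unitary_representation pi, cocycle pi b,
        large_scale_lipschitz l b & c = compression l b]].

Section DirectSum.
Variable F : nat -> finGroupType.

Record dsum := DSum {
  dsum_fun :> forall i, F i;
  dsum_finite : finite_set [set i | dsum_fun i != 1%g]
}.

Lemma dsum_eq (g h : dsum) : (forall i, g i = h i) -> g = h.
Proof.
case: g h => [g fg] [h fh] /= gh.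
have {}gh : g = h by apply: functional_extensionality_dep.
by rewrite gh in fg *; rewrite (Prop_irrelevance fg fh).
Qed.

Lemma dsum_one_finite : finite_set [set i | (1%g : F i) != 1%g].
Proof. by apply: (sub_finite_set _ (@finite_set0 nat)) => i /=; rewrite eqxx. Qed.

Lemma dsum_inv_finite (g : dsum) : finite_set [set i | (g i)^-1%g != 1%g].
Proof.
by apply: sub_finite_set (dsum_finite g) => i /=; rewrite invg_eq1.
Qed.

Lemma dsum_mul_finite (g h : dsum) :
  finite_set [set i | (g i * h i)%g != 1%g].
Proof.
have fgh : finite_set ([set i | g i != 1%g] `|` [set i | h i != 1%g]).
  by rewrite finite_setU; split; apply: dsum_finite.
apply: sub_finite_set fgh => i /=.
by case: (eqVneq (g i) 1%g) => [->|gi _]; [rewrite mul1g; right | left].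
Qed.

Definition dsum_one := DSum dsum_one_finite.
Definition dsum_inv g := DSum (dsum_inv_finite g).
Definition dsum_mul g h := DSum (dsum_mul_finite g h).

Lemma dsum_mulA : associative dsum_mul.
Proof. by move=> f g h; apply: dsum_eq => i /=; rewrite mulgA. Qed.
Lemma dsum_mul1 : left_id dsum_one dsum_mul.
Proof. by move=> g; apply: dsum_eq => i /=; rewrite mul1g. Qed.
Lemma dsum_mulr1 : right_id dsum_one dsum_mul.
Proof. by move=> g; apply: dsum_eq => i /=; rewrite mulg1. Qed.
Lemma dsum_mulV : left_inverse dsum_one dsum_inv dsum_mul.
Proof. by move=> g; apply: dsum_eq => i /=; rewrite mulVg. Qed.
Lemma dsum_mulrV : right_inverse dsum_one dsum_inv dsum_mul.
Proof. by move=> g; apply: dsum_eq => i /=; rewrite mulgV. Qed.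

HB.instance Definition _ := gen_eqMixin dsum.
HB.instance Definition _ := gen_choiceMixin dsum.
HB.instance Definition _ :=
  isGroup.Build dsum dsum_mulA dsum_mul1 dsum_mulr1 dsum_mulV dsum_mulrV.

(* [g] lies in the subgroup of [dsum] that is the direct sum of [F 0 .. F n]. *)
Definition in_partial_dsum (n : nat) (g : dsum) : Prop :=
  forall i, (n < i)%N -> g i = 1%g.

Lemma in_partial_dsum_ex (g : dsum) : exists n, `[< in_partial_dsum n g >].
Proof.
have /finite_seqP[s sE] := dsum_finite g.
exists (\max_(i <- s) i)%N; apply/asboolP => i; rewrite ltnNge.
apply: contraNeq => gi; apply: (@leq_bigmax_seq _ _ _ id) => //.
by have : [set i | g i != 1%g] i by []; rewrite sE.
Qed.

Definition dsum_length (g : dsum) : nat := ex_minn (in_partial_dsum_ex g).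

Lemma dsum_lengthP (g : dsum) (n : nat) :
  (dsum_length g <= n)%N <-> in_partial_dsum n g.
Proof.
rewrite /dsum_length; case: ex_minnP => m /asboolP mg mmin; split.
  by move=> mn i ni; apply: mg; apply: leq_ltn_trans ni.
by move=> ng; apply: mmin; apply/asboolP.
Qed.

End DirectSum.

(* Main.v *)
Require Import Defs.
From HB Require Import structures.
From mathcomp Require Import all_boot all_order all_fingroup all_algebra.
From mathcomp Require Import finmap sesquilinear complex ring lra.
From mathcomp Require Import all_classical all_reals all_analysis.

(* Let K_n be the subgroup of elements of length at most n. The coset space G / K_n carries the
   coboundary g |-> delta_{g K_n} - delta_{K_n} of l^2(G / K_n), which vanishes on K_n and has
   squared norm 2 elsewhere. The direct sum over n is therefore a cocycle b, with
   |b(g)|^2 = 2 l(g), so that the exponent 1/2 >= 1/3 is admissible. *)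

Set Implicit Arguments.
Unset Strict Implicit.
Unset Printing Implicit Defensive.

Import Order.TTheory GRing.Theory Num.Theory.
Import numFieldNormedType.Exports.

Local Open Scope classical_set_scope.
Local Open Scope ring_scope.
Local Open Scope complex_scope.

(** * Unordered sums of real families *)

Section RealSums.
Variables (R : realType) (X : choiceType).
Implicit Types (p q : X -> R).

(** [fine] sends an infinite sum to 0, so the value is meaningful only for summable families. *)
Definition nnsum p : R := fine (\esum_(x in [set: X]) (p x)%:E).
Definition abs_summable p : Prop := summable [set: X] (fun x => (p x)%:E).

Lemma abs_summable_le p q : (forall x, `|p x| <= `|q x|) ->
  abs_summable q -> abs_summable p.
Proof. by move=> pq; apply: le_lt_trans; apply: le_esum => x _; rewrite lee_fin. Qed.

Lemma abs_summableD p q : abs_summable p -> abs_summable q ->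
  abs_summable (fun x => p x + q x).
Proof. exact: summableD. Qed.

Lemma abs_summable_norm p : abs_summable p -> abs_summable (fun x => `|p x|).
Proof. by apply: abs_summable_le => x; rewrite normr_id. Qed.

(** [\esum] is a supremum of finite sums, and a factor [c >= 0] commutes both with finite sums and
    with the supremum of a nonempty set. *)
Lemma esumZl (c : R) p : 0 <= c ->
  (\esum_(x in [set: X]) (c * p x)%:E = c%:E * \esum_(x in [set: X]) (p x)%:E)%E.
Proof.
move=> c0; rewrite /esum -ereal_supZl//; last first.
  by apply/set0P; exists 0%E; exists set0; rewrite ?fsbig_set0//; exact: fsets_set0.
rewrite image_comp; congr ereal_sup; apply: eq_imagel => A [finA _] /=.
by rewrite !fsumEFin// -EFinM mulr_fsumr.
Qed.

Lemma abs_summableZ c p : abs_summable p -> abs_summable (fun x => c * p x).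
Proof.
rewrite /abs_summable /summable => sp.
under eq_esum do rewrite abse_EFin normrM.
rewrite esumZl//.
move: sp; rewrite -ge0_fin_numE; last exact: esum_ge0.
by move=> sp; rewrite -ge0_fin_numE ?fin_numM// mule_ge0// esum_ge0.
Qed.

Lemma nnsumE p : (forall x, 0 <= p x) -> abs_summable p ->
  (\esum_(x in [set: X]) (p x)%:E = (nnsum p)%:E)%E.
Proof.
move=> p0 sp; rewrite /nnsum fineK// ge0_fin_numE; last first.
  by apply: esum_ge0 => x _; rewrite lee_fin.
by apply: le_lt_trans sp; apply: le_esum => x _; rewrite lee_fin ler_norm.
Qed.

Lemma eq_nnsum p q : (forall x, p x = q x) -> nnsum p = nnsum q.
Proof. by move=> pq; congr nnsum; apply/funext. Qed.

Lemma nnsumD p q : (forall x, 0 <= p x) -> (forall x, 0 <= q x) ->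
  abs_summable p -> abs_summable q ->
  nnsum (fun x => p x + q x) = nnsum p + nnsum q.
Proof.
move=> p0 q0 sp sq; apply: EFin_inj.
rewrite EFinD -(nnsumE p0 sp) -(nnsumE q0 sq) -nnsumE; first last.
- exact: abs_summableD.
- by move=> x; rewrite addr_ge0.
- under eq_esum do rewrite EFinD.
  by rewrite esumD// => x _; rewrite lee_fin.
Qed.

Lemma nnsumZ c p : 0 <= c -> nnsum (fun x => c * p x) = c * nnsum p.
Proof.
move=> c0; rewrite /nnsum esumZl//; have [->|c_gt0] := eqVneq c 0.
  by rewrite mul0e mul0r.
have {}c_gt0 : 0 < c by rewrite lt_def c_gt0.
(* An infinite sum stays infinite under a factor [c > 0], and [fine] then makes both sides 0. *)
by case: esum => [r||] //=; rewrite ?gt0_muley ?gt0_muleNy ?lte_fin//= mulr0.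
Qed.

Lemma nnsum_ge0 p : (forall x, 0 <= p x) -> 0 <= nnsum p.
Proof. by move=> p0; apply/fine_ge0/esum_ge0 => x _; rewrite lee_fin. Qed.

Lemma nnsum_ge_term p x : (forall x, 0 <= p x) -> abs_summable p -> p x <= nnsum p.
Proof.
move=> p0 sp; rewrite -lee_fin -nnsumE//; apply: esum_ge.
by exists [set x]; rewrite ?fsbig_set1//; split.
Qed.

Lemma nnsum0 p : (forall x, p x = 0) -> nnsum p = 0.
Proof. by move=> p0; rewrite /nnsum esum1// => x _; rewrite p0. Qed.

(** Both conclusions come from taking the supremum over finite [A]. In the completeness proof this
    turns bounds on finite partial sums of a pointwise limit into a bound on its norm. *)
Lemma nnsum_bounded p M : (forall x, 0 <= p x) ->
  (forall A : set X, finite_set A -> \sum_(x \in A) p x <= M) ->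
  abs_summable p /\ nnsum p <= M.
Proof.
move=> p0 pM.
have pM' : (\esum_(x in [set: X]) (p x)%:E <= M%:E)%E.
  by rewrite ge_ereal_sup// => _ [A [finA _] <-]; rewrite fsumEFin// lee_fin pM.
have sp : abs_summable p.
  apply: (@le_lt_trans _ _ M%:E); rewrite ?ltry//; apply: le_trans pM'.
  by apply: le_esum => x _; rewrite lee_fin ger0_norm.
by split=> //; rewrite -lee_fin -nnsumE.
Qed.

Lemma fsum_le_nnsum p (A : set X) : finite_set A -> (forall x, 0 <= p x) ->
  abs_summable p -> \sum_(x \in A) p x <= nnsum p.
Proof.
move=> finA p0 sp; rewrite -lee_fin -nnsumE// -fsumEFin//.
by apply: ereal_sup_ubound; exists A.
Qed.

Lemma nnsum_bij (e : X -> X) p : bijective e -> nnsum (p \o e) = nnsum p.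
Proof.
move=> bije; congr fine; apply/esym.
by apply: (reindex_esum setT setT e (fun x => (p x)%:E)); rewrite setTT_bijective.
Qed.

(** Signed sums are reduced to nonnegative ones through [p = (|p| + p) - |p|], where both families
    on the right are nonnegative. *)
Definition rsum p : R := nnsum (fun x => `|p x| + p x) - nnsum (fun x => `|p x|).

Lemma norm_addr_ge0 (a : R) : 0 <= `|a| + a.
Proof. by rewrite -lerBlDr sub0r -normrN ler_norm. Qed.

Let summable_nadd p : abs_summable p -> abs_summable (fun x => `|p x| + p x).
Proof. by move=> sp; apply: abs_summableD => //; exact: abs_summable_norm. Qed.

Lemma rsum_ge0E p : (forall x, 0 <= p x) -> abs_summable p -> rsum p = nnsum p.
Proof.
move=> p0 sp; rewrite /rsum nnsumD//; last exact: abs_summable_norm.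
by rewrite addrAC subrr add0r.
Qed.

Lemma rsumD p q : abs_summable p -> abs_summable q ->
  rsum (fun x => p x + q x) = rsum p + rsum q.
Proof.
move=> sp sq; have spq := abs_summableD sp sq.
apply/eqP; rewrite /rsum subr_eq -!addrA; apply/eqP.
have nsp := abs_summable_norm sp; have nsq := abs_summable_norm sq.
have nspq := abs_summable_norm spq.
have sap := summable_nadd sp; have saq := summable_nadd sq.
have sapq := summable_nadd spq; have nadd := norm_addr_ge0.
(* Moving every subtracted sum to the other side leaves an identity between sums of nonnegative
   families, which [nnsumD] reduces to a pointwise one. *)
apply: (@addIr _ (nnsum (fun x => `|p x|) + nnsum (fun x => `|q x|))).
transitivity (nnsum (fun x => `|p x| + p x) + nnsum (fun x => `|q x| + q x) +
  nnsum (fun x => `|p x + q x|)); last by lra.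
rewrite -!nnsumD//; do ?[exact: abs_summableD | by move=> x; rewrite addr_ge0].
by apply: eq_nnsum => x; lra.
Qed.

Lemma rsumZ c p : abs_summable p -> rsum (fun x => c * p x) = c * rsum p.
Proof.
(* For [c <= 0] write [c p = (- c) (- p)]; the sum of [- p] is the opposite of that of [p] because
   additivity makes the two add up to 0. *)
move=> sp; wlog c0 : c p sp / 0 <= c => [hwlog|].
  have [/hwlog->//|/ltW c0] := leP 0 c.
  have spN : abs_summable (fun x => -1 * p x) by exact: abs_summableZ.
  have -> : (fun x => c * p x) = (fun x => - c * (-1 * p x)).
    by apply/funext => x; lra.
  rewrite hwlog ?oppr_ge0//.
  suff /eqP : rsum p + rsum (fun x => -1 * p x) = 0.
    by rewrite addrC addr_eq0 => /eqP ->; rewrite mulrNN.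
  rewrite -rsumD// /rsum !nnsum0 ?subrr// => x;
    rewrite mulN1r subrr ?normr0 ?addr0//.
rewrite /rsum mulrBr -!nnsumZ//; congr (_ - _); apply: eq_nnsum => x;
  by rewrite normrM (ger0_norm c0)// mulrDr.
Qed.

Lemma rsumN p : abs_summable p -> rsum (fun x => - p x) = - rsum p.
Proof.
by move=> sp; rewrite -mulN1r -rsumZ//; congr rsum; apply/funext => x; rewrite mulN1r.
Qed.

Lemma rsum_bij (e : X -> X) p : bijective e -> rsum (p \o e) = rsum p.
Proof.
by move=> bije; rewrite /rsum -(nnsum_bij (fun x => `|p x| + p x) bije)
  -(nnsum_bij (fun x => `|p x|) bije).
Qed.

End RealSums.

(** * The Hilbert space of square summable families *)

(** Squaring reduces this to the Cauchy-Schwarz bound on the cross terms, which is positivity of the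
    form at one well-chosen vector. Zero vectors are treated apart because the product of the two
    norms gets cancelled. *)
Lemma sqrtC_dnormD (C : numClosedFieldType) (U : lmodType C)
    (form : {dot U for Num.conj}) (u v : U) :
  sqrtC (form (u + v) (u + v)) <= sqrtC (form u u) + sqrtC (form v v).
Proof.
have [->|u0] := eqVneq u 0; first by rewrite add0r linear0l sqrtC0 add0r.
have [->|v0] := eqVneq v 0; first by rewrite addr0 linear0l sqrtC0 addr0.
set s := sqrtC (form u u); set t := sqrtC (form v v).
have s0 : 0 < s by rewrite sqrt_dnorm_gt0.
have t0 : 0 < t by rewrite sqrt_dnorm_gt0.
rewrite -ler_sqr ?nnegrE ?addr_ge0 ?(ltW s0) ?(ltW t0) ?sqrt_dnorm_ge0//.
rewrite sqrtCK dnormD -[form u u]sqrtCK -[form v v]sqrtCK -/s -/t sqrrD.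
rewrite addrAC lerD2r lerD2l -(ler_pM2l (mulr_gt0 s0 t0)).
(* [t u] and [s v] have the same norm [s t]. *)
have := dnorm_ge0 form (t *: u - s *: v).
rewrite dnormB !dnormZ -[form u u]sqrtCK -[form v v]sqrtCK -/s -/t.
have -> : form (t *: u) (s *: v) = t * s * form u v.
  rewrite (linearZl_LR form (s *: v)) /= (linearZr_LR form u) /=.
  by rewrite (CrealP (gtr0_real s0)) mulrA.
rewrite !(gtr0_norm s0) !(gtr0_norm t0) !rmorphM/=.
rewrite (CrealP (gtr0_real s0)) (CrealP (gtr0_real t0)) subr_ge0.
suff -> : t ^+ 2 * s ^+ 2 + s ^+ 2 * t ^+ 2 = s * t * (s * t *+ 2).
  by rewrite -mulrDr [t * s]mulrC.
by ring.
Qed.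

Section SquareSummable.
Variables (R : realType) (X : choiceType).
Notation C := R[i].
Notation Re := (@complex.Re R).
Notation Im := (@complex.Im R).
Implicit Types (f g : X -> C) (z w : C).

(** The squared modulus as an element of [R]: the norm of [R[i]] takes values in [R[i]], whereas the
    sums above are over real families. *)
Definition normsq z : R := Re z ^+ 2 + Im z ^+ 2.

Lemma normsq_ge0 z : 0 <= normsq z.
Proof. by rewrite addr_ge0 ?sqr_ge0. Qed.

Lemma normsqE z : (normsq z)%:C = `|z| ^+ 2.
Proof. exact: add_Re2_Im2. Qed.

Lemma normsqM z w : normsq (z * w) = normsq z * normsq w.
Proof. by apply: complexI; rewrite rmorphM/= !normsqE normrM exprMn. Qed.

Lemma normsqD_le z w : normsq (z + w) <= 2 * normsq z + 2 * normsq w.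
Proof.
case: z w => [a b] [c d]; rewrite /normsq/=.
by have := sqr_ge0 (a - c); have := sqr_ge0 (b - d); lra.
Qed.

(** Expanding the squares of sums and differences of coordinates gives these bounds. They dominate
    the terms of the inner product by a summable family. *)
Lemma normsq_conj_le z w :
  `|Re (z * w^*%C)| <= normsq z + normsq w /\ `|Im (z * w^*%C)| <= normsq z + normsq w.
Proof.
case: z w => [a b] [c d]; rewrite /normsq/=.
have := sqr_ge0 (a - c); have := sqr_ge0 (a + c); have := sqr_ge0 (b - d).
have := sqr_ge0 (b + d); have := sqr_ge0 (a - d); have := sqr_ge0 (a + d).
have := sqr_ge0 (b - c); have := sqr_ge0 (b + c) => *.
by split; rewrite ler_norml; apply/andP; split; lra.
Qed.

Definition csummable f := abs_summable (Re \o f) /\ abs_summable (Im \o f).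

Definition csum f : C := rsum (Re \o f) +i* rsum (Im \o f).

Lemma csumD f g : csummable f -> csummable g ->
  csum (fun x => f x + g x) = csum f + csum g.
Proof.
move=> [rf jf] [rg jg]; rewrite /csum [RHS]/GRing.add/= -!rsumD//.
by congr (_ +i* _); congr rsum; apply/funext => x/=; case: (f x) (g x) => [a b] [].
Qed.

Lemma csumZ (a : C) f : csummable f -> csum (fun x => a * f x) = a * csum f.
Proof.
case: a => a b [rf jf]; rewrite /csum [RHS]/GRing.mul/= -mulNr -!rsumZ//.
rewrite -!rsumD//; do ?exact: abs_summableZ.
by congr (_ +i* _); congr rsum; apply/funext => x/=; case: (f x) => [c d]/=; ring.
Qed.

Lemma csum_conj f : csummable f -> csum (fun x => (f x)^*%C) = (csum f)^*%C.
Proof.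
move=> [rf jf]; rewrite /csum/= -rsumN//.
by congr (_ +i* _); congr rsum; apply/funext => x/=; case: (f x) => [c d].
Qed.

Lemma csum_bij (e : X -> X) f : bijective e -> csum (f \o e) = csum f.
Proof.
by move=> bije; rewrite /csum -(rsum_bij (Re \o f) bije) -(rsum_bij (Im \o f) bije).
Qed.

(** Stated as a boolean predicate so that it can carry a submodule structure, from which [ell2]
    inherits its own. *)
Definition square_summable : {pred X -> C} :=
  fun f => `[< abs_summable (normsq \o f) >].

Lemma square_summableP f :
  reflect (abs_summable (normsq \o f)) (f \in square_summable).
Proof. exact: asboolP. Qed.

Lemma square_summable_submod : submod_closed square_summable.
Proof.
split=> [|a f g /square_summableP sf /square_summableP sg]; apply/square_summableP.
  apply: (@abs_summable_le _ _ _ (fun=> 0)) => [x|]; last first.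
    by rewrite /abs_summable /summable esum1// => x _ /=; rewrite normr0.
  by rewrite /normsq/= !expr0n/= addr0 normr0.
apply: (@abs_summable_le _ _ _
  (fun x => 2 * normsq a * (normsq \o f) x + 2 * (normsq \o g) x)); last first.
  by apply: abs_summableD; exact: abs_summableZ.
move=> x /=; rewrite ger0_norm ?normsq_ge0// ger0_norm; last first.
  by rewrite addr_ge0 ?mulr_ge0 ?normsq_ge0.
by apply: le_trans (normsqD_le _ _) _; rewrite normsqM mulrA.
Qed.

HB.instance Definition _ :=
  GRing.isSubmodClosed.Build C (X -> C) square_summable square_summable_submod.

Record ell2 := Ell2 {
  ell2_fun :> X -> C;
  ell2P : ell2_fun \in square_summable
}.

HB.instance Definition _ := [isSub for ell2_fun].
HB.instance Definition _ := [Choice of ell2 by <:].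
HB.instance Definition _ := [SubChoice_isSubLmodule of ell2 by <:].

Implicit Types u v : ell2.

Lemma ell2_summable u : abs_summable (fun x => normsq (u x)).
Proof. exact/square_summableP/ell2P. Qed.

Lemma ell2_eq u v : (forall x, u x = v x) -> u = v.
Proof. by move=> uv; apply: val_inj; apply/funext. Qed.

Lemma ell2DE u v x : (u + v) x = u x + v x. Proof. by []. Qed.
Lemma ell2BE u v x : (u - v) x = u x - v x. Proof. by []. Qed.

Definition ell2_inner u v : C := csum (fun x => u x * (v x)^*%C).

Lemma ell2_inner_csummable u v : csummable (fun x => u x * (v x)^*%C).
Proof.
have suv := abs_summableD (ell2_summable u) (ell2_summable v).
split; apply: abs_summable_le suv => x;
  rewrite [leRHS]ger0_norm ?(addr_ge0 (normsq_ge0 _) (normsq_ge0 _))//;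
  by have [] := normsq_conj_le (u x) (v x).
Qed.

Lemma ell2_inner_conj u v : ell2_inner u v = Num.Def.conjC (ell2_inner v u).
Proof.
rewrite -[RHS]/((ell2_inner v u)^*%C) -csum_conj; last exact: ell2_inner_csummable.
by congr csum; apply/funext => x; rewrite rmorphM/= conjcK mulrC.
Qed.

Lemma ell2_inner_linear v : GRing.linear_for *%R (ell2_inner^~ v).
Proof.
move=> a u w; rewrite /= /ell2_inner -csumZ; last exact: ell2_inner_csummable.
rewrite -csumD; last 2 first.
- rewrite (_ : (fun x => _) = fun x => (a *: u) x * (v x)^*%C); last first.
    by apply/funext => x; rewrite mulrA.
  exact: ell2_inner_csummable.
- exact: ell2_inner_csummable.
by congr csum; apply/funext => x; rewrite mulrA -mulrDl.
Qed.

Lemma ell2_inner_bilinear :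
  bilinear_for *%R (Num.Def.conjC \; *%R) ell2_inner.
Proof.
split=> [v|u]; first exact: ell2_inner_linear.
move=> a v w; rewrite ell2_inner_conj ell2_inner_linear rmorphD rmorphM /=.
by rewrite [in RHS]ell2_inner_conj [ell2_inner u w in RHS]ell2_inner_conj.
Qed.

HB.instance Definition _ :=
  bilinear_isBilinear.Build C ell2 ell2 C _ _ ell2_inner ell2_inner_bilinear.

Lemma ell2_inner_hermitian u v :
  ell2_inner u v = (-1) ^+ false * Num.Def.conjC (ell2_inner v u).
Proof. by rewrite expr0 mul1r -ell2_inner_conj. Qed.

HB.instance Definition _ :=
  isHermitianSesquilinear.Build C ell2 false _ ell2_inner ell2_inner_hermitian.

Lemma ell2_innerxx u : ell2_inner u u = (nnsum (fun x => normsq (u x)))%:C.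
Proof.
rewrite -rsum_ge0E; last 2 first.
- by move=> x; exact: normsq_ge0.
- exact: ell2_summable.
congr (_ +i* _).
  congr rsum; apply/funext => x; rewrite /= /normsq.
  by case: (u x) => a b /=; ring.
have im0 x : Im (u x * (u x)^*%C) = 0 by case: (u x) => a b /=; ring.
by rewrite /rsum !nnsum0 ?subrr// => x /=; rewrite im0 normr0 ?addr0.
Qed.

Lemma ell2_normsq_le u x : normsq (u x) <= nnsum (fun x => normsq (u x)).
Proof.
apply: (@nnsum_ge_term _ _ (fun x => normsq (u x))) => [y|].
  exact: normsq_ge0.
exact: ell2_summable.
Qed.

Lemma ell2_inner_gt0 u : u != 0 -> 0 < ell2_inner u u.
Proof.
move=> u0; rewrite ell2_innerxx ltcR lt_def nnsum_ge0 ?andbT; last first.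
  by move=> x; exact: normsq_ge0.
apply: contra_neq u0 => u0; apply: ell2_eq => x.
apply/eqP; rewrite -normr_eq0 -sqrf_eq0 -normsqE.
rewrite (_ : 0 = 0%:C)//; apply/eqP; congr _%:C; apply/eqP.
by rewrite eq_le normsq_ge0 -u0 ell2_normsq_le.
Qed.

HB.instance Definition _ := isDotProduct.Build C ell2 ell2_inner ell2_inner_gt0.

Definition ell2_norm u : C := sqrtC (ell2_inner u u).

Lemma ell2_norm_sqr u : ell2_norm u ^+ 2 = ell2_inner u u.
Proof. exact: sqrtCK. Qed.

Lemma ell2_normD u v : ell2_norm (u + v) <= ell2_norm u + ell2_norm v.
Proof. exact: sqrtC_dnormD. Qed.

Lemma ell2_normZ (a : C) u : ell2_norm (a *: u) = `|a| * ell2_norm u.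
Proof.
rewrite /ell2_norm (dnormZ ell2_inner) sqrtCM ?qualifE/= ?exprn_ge0 ?dnorm_ge0//.
by rewrite sqrCK.
Qed.

Lemma ell2_norm_eq0 u : ell2_norm u = 0 -> u = 0.
Proof. by move=> /eqP; rewrite sqrtC_eq0 dnorm_eq0 => /eqP. Qed.

HB.instance Definition _ :=
  Lmodule_isNormed.Build C ell2 ell2_normD ell2_normZ ell2_norm_eq0.

Lemma ell2_normE u : `|u| = (Num.sqrt (nnsum (fun x => normsq (u x))))%:C.
Proof.
rewrite -[LHS]/(ell2_norm u) /ell2_norm ell2_innerxx.
apply/eqP; rewrite -(@eqrXn2 _ 2)// ?sqrtC_ge0 ?lecR ?sqrtr_ge0//; last first.
  by apply: nnsum_ge0 => x; exact: normsq_ge0.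
rewrite sqrtCK -rmorphXn/= sqr_sqrtr//.
by apply: nnsum_ge0 => x; exact: normsq_ge0.
Qed.

Lemma ell2_norm_ltP u (e : R) : 0 < e ->
  `|u| < e%:C -> nnsum (fun x => normsq (u x)) < e ^+ 2.
Proof.
move=> e0; rewrite ell2_normE ltcR => ue.
by rewrite -ltr_sqrt ?exprn_gt0// sqrtr_sqr gtr0_norm.
Qed.

End SquareSummable.

(** * Completeness of the space of square summable families *)

Section Ell2Complete.
Variables (R : realType) (X : choiceType).
Notation C := R[i].
Notation Re := (@complex.Re R).
Notation Im := (@complex.Im R).
Implicit Types u v w : ell2 R X.

Lemma ell2_normsq_le_norm u x : (Num.sqrt (normsq (u x)))%:C <= `|u|.
Proof. by rewrite ell2_normE lecR ler_wsqrtr// ell2_normsq_le. Qed.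

(** A 1-Lipschitz function carries a Cauchy filter to a Cauchy filter, and [R] is complete. It is
    applied to the real and imaginary parts of each coordinate. *)
Lemma ell2_lipschitz_cauchy_cvg (F : set_system (ell2 R X))
    (phi : ell2 R X -> R) : ProperFilter F -> cauchy F ->
  (forall u v, (`|phi u - phi v|)%:C <= `|u - v|) -> cvg (phi @ F).
Proof.
move=> FF /cauchyP Fc lip; apply/cauchy_cvgP/cauchy_exP => e e0.
have [|u Fu] := Fc e%:C; first by rewrite ltcR.
exists (phi u).
apply: (@filterS _ F _ (ball u e%:C) (phi @^-1` ball (phi u) e)) Fu => v.
rewrite -ball_normE /= => uv; rewrite /ball/= -ltcR.
exact: le_lt_trans (lip _ _) uv.
Qed.

Lemma normr_Re_le (z : C) : `|Re z| <= Num.sqrt (normsq z).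
Proof. by rewrite -sqrtr_sqr ler_wsqrtr// lerDl sqr_ge0. Qed.

Lemma normr_Im_le (z : C) : `|Im z| <= Num.sqrt (normsq z).
Proof. by rewrite -sqrtr_sqr ler_wsqrtr// lerDr sqr_ge0. Qed.

(** The limit is built coordinate by coordinate. A Fatou-type bound then shows both that it is
    square summable and that the filter converges to it in norm. *)
Lemma ell2_complete (F : set_system (ell2 R X)) :
  ProperFilter F -> cauchy F -> cvg F.
Proof.
move=> FF Fc.
pose f x : C := lim ((fun u => Re (u x)) @ F) +i* lim ((fun u => Im (u x)) @ F).
have cre x : (fun u => Re (u x)) @ F --> Re (f x).
  apply: ell2_lipschitz_cauchy_cvg => // u v.
  apply: le_trans (ell2_normsq_le_norm (u - v) x); rewrite lecR.
  by apply: le_trans (normr_Re_le _); rewrite ell2BE; case: (u x) (v x) => [a b] [].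
have cim x : (fun u => Im (u x)) @ F --> Im (f x).
  apply: ell2_lipschitz_cauchy_cvg => // u v.
  apply: le_trans (ell2_normsq_le_norm (u - v) x); rewrite lecR.
  by apply: le_trans (normr_Im_le _); rewrite ell2BE; case: (u x) (v x) => [a b] [].
have cnormsq v x : (fun u => normsq (u x - v x)) @ F --> normsq (f x - v x).
  rewrite /normsq.
  have -> : (fun u : ell2 R X => Re (u x - v x) ^+ 2 + Im (u x - v x) ^+ 2) =
      (fun u => (Re (u x) - Re (v x)) ^+ 2 + (Im (u x) - Im (v x)) ^+ 2).
    by apply/funext => u; case: (u x) (v x) => [a b] [].
  have -> : Re (f x - v x) ^+ 2 + Im (f x - v x) ^+ 2 =
      (Re (f x) - Re (v x)) ^+ 2 + (Im (f x) - Im (v x)) ^+ 2.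
    by case: (v x) => [a b].
  by rewrite /= !expr2; apply: cvgD; apply: cvgM; apply: cvgB => //; exact: cvg_cst.
(* Fatou-type bound: for finite [A], every [u] in the ball has its partial sum of
   [normsq (u x - v x)] over [A] at most [e ^+ 2]. This survives the pointwise limit, and [A] is
   arbitrary. *)
have close v (e : R) : 0 < e -> F (ball v e%:C) ->
    abs_summable (fun x => normsq (f x - v x)) /\
    nnsum (fun x => normsq (f x - v x)) <= e ^+ 2.
  move=> e0 Fv; apply: nnsum_bounded => [x|A finA]; first exact: normsq_ge0.
  rewrite fsbig_finite//=.
  have csum : (fun u : ell2 R X => \sum_(x <- fset_set A) normsq (u x - v x)) @ F -->
      \sum_(x <- fset_set A) normsq (f x - v x).
    by apply: cvg_big => [|x _]; [exact: add_continuous | exact: cnormsq].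
  apply: (cvgr_to_le csum); apply: filterS Fv => u.
  rewrite -ball_normE /= distrC => /(ell2_norm_ltP e0).
  move=> /ltW; apply: le_trans; rewrite -fsbig_finite//.
  apply: (@fsum_le_nnsum _ _ (fun x => normsq ((u - v) x))) => // [x|].
    exact: normsq_ge0.
  exact: ell2_summable.
have Fex (e : R) : 0 < e -> exists v, F (ball v e%:C).
  by move=> e0; apply: (iffLR (cauchyP F)) => //; rewrite ltcR.
have [v0 Fv0] := Fex 1 ltr01.
have [sfv0 _] := close _ _ ltr01 Fv0.
(* The limit differs from the square summable [v0] by a square summable family. *)
have sf : f \in @square_summable R X.
  have -> : f = (f - (v0 : X -> C)) + (v0 : X -> C) by rewrite subrK.
  by apply: rpredD; [apply/square_summableP | exact: ell2P].
apply/cvg_ex; exists (Ell2 sf).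
apply/cvgrPdist_le => e e0.
(* A positive element of [R[i]] is real, so radii may be taken in [R]. *)
have eE : e = (Re e)%:C by rewrite RRe_real// gtr0_real.
rewrite eE in e0 *; move: (Re e) e0 => {eE}e; rewrite ltcR => e0.
(* For [F]-almost every [v], the ball of radius [e] around [v] belongs to [F], so [close] bounds the
   distance from [v] to the limit. *)
have /cauchy_ballP/(_ (e%:C)) := Fc; rewrite ltcR => /(_ e0).
move=> /nearP_dep; apply: filterS => v /(close _ _ e0)[sfv fve].
rewrite ell2_normE lecR -(ler_sqr) ?nnegrE ?sqrtr_ge0 ?(ltW e0)// sqr_sqrtr//.
by apply: nnsum_ge0 => x; exact: normsq_ge0.
Qed.

HB.instance Definition _ := Uniform_isComplete.Build (ell2 R X) ell2_complete.

Lemma ell2_innerE u : ell2_inner u u = `|u| ^+ 2.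
Proof. by rewrite -ell2_norm_sqr. Qed.

Definition ell2_hilbert : hilbertType R :=
  @HilbertType R (ell2 R X) (@ell2_inner R X) ell2_innerE.

End Ell2Complete.

(** * Unitary reindexing and Dirac masses *)

Section Reindexing.
Variables (R : realType) (X : choiceType) (e : X -> X) (bij_e : bijective e).

Lemma square_summable_comp (u : ell2 R X) : (u : X -> R[i]) \o e \in @square_summable R X.
Proof.
apply/square_summableP; rewrite /abs_summable /summable.
have := ell2_summable u; rewrite /abs_summable /summable.
by rewrite (reindex_esum setT setT e)// setTT_bijective.
Qed.

Definition ell2_comp (u : ell2 R X) : ell2 R X := Ell2 (square_summable_comp u).

Lemma ell2_comp_linear : linear ell2_comp.
Proof. by move=> a u v; apply: ell2_eq. Qed.

HB.instance Definition _ :=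
  GRing.isLinear.Build R[i] (ell2 R X) (ell2 R X) _ ell2_comp ell2_comp_linear.

Lemma ell2_comp_isometry : isometry (@ell2_inner R X) (@ell2_inner R X) ell2_comp.
Proof.
by move=> u v; exact: (csum_bij (fun x => u x * (v x)^*%C) bij_e).
Qed.

End Reindexing.

Lemma ell2_comp_unitary (R : realType) (X : choiceType) (e : X -> X)
    (bij_e : bijective e) :
  unitary (H := ell2_hilbert R X) (@ell2_comp R X e bij_e).
Proof.
split; first exact: ell2_comp_isometry.
have [e' eK e'K] := bij_e.
have bij_e' : bijective e' by exists e.
exists (ell2_comp bij_e') => u; apply: ell2_eq => x; by rewrite /= ?eK ?e'K.
Qed.

Section Deltas.
Variables (R : realType) (X : choiceType).

Lemma nnsum_delta (y : X) :
  abs_summable (fun x : X => (x == y)%:R : R) /\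
  nnsum (fun x : X => (x == y)%:R : R) = 1.
Proof.
have E : (\esum_(x in [set: X]) ((x == y)%:R : R)%:E = 1)%E.
  rewrite -[RHS](@esum_set1 R X y (fun=> 1%E))// [RHS]esum_mkcond.
  by apply: eq_esum => x _; case: eqVneq => [->|/eqP xy]; [rewrite mem_set|rewrite memNset].
split; last by rewrite /nnsum E.
rewrite /abs_summable /summable.
under eq_esum do rewrite /= ger0_norm//.
by rewrite E ltry.
Qed.

(** Each Dirac mass contributes 1, counted with multiplicity, so the points [y i] and [z i] may
    coincide. *)
Lemma nnsum_sum_deltas (I : Type) (s : seq I) (y z : I -> X) :
  let p x := \sum_(i <- s) ((x == y i)%:R + (x == z i)%:R) : R in
  abs_summable p /\ nnsum p = (2 * size s)%:R.
Proof.
elim: s => [|i s [sIH IH]] /=.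
  have p0 x : \sum_(i <- [::]) ((x == y i)%:R + (x == z i)%:R) = 0 :> R.
    by rewrite big_nil.
  split; last by rewrite nnsum0.
  by rewrite /abs_summable /summable esum1// => x _ /=; rewrite p0 normr0.
have [sy ny] := nnsum_delta (y i); have [sz nz] := nnsum_delta (z i).
have -> : (fun x => \sum_(j <- i :: s) ((x == y j)%:R + (x == z j)%:R)) =
    (fun x => ((x == y i)%:R + (x == z i)%:R)
       + \sum_(j <- s) ((x == y j)%:R + (x == z j)%:R)) :> (X -> R).
  by apply/funext => x; rewrite big_cons.
have syz := abs_summableD sy sz.
split; first exact: abs_summableD.
rewrite nnsumD//.
- by rewrite nnsumD// ny nz IH mulnS natrD.
- by move=> x; rewrite sumr_ge0// => j _; rewrite addr_ge0.
Qed.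

End Deltas.

(** * The cocycle of an ultrametric length *)

Section UltrametricLength.
Variables (R : realType) (G : groupType) (l : G -> nat).
Hypothesis l1 : l 1%g = 0%N.
Hypothesis lV : forall g, l g^-1%g = l g.
Hypothesis lM : forall g h, (l (g * h)%g <= maxn (l g) (l h))%N.

(** The hypotheses on [l] make this a subgroup: it is the [K_n] of the construction. *)
Definition length_ball (n : nat) : set G := [set g | (l g <= n)%N].

(* [translate g] sends [A] to [g^-1 A]. It acts on all subsets of [G] rather than on cosets of the
   balls, which spares the quotients; the index [n] keeps equal balls apart. *)
Definition translate (g : G) (x : nat * set G) : nat * set G :=
  (x.1, [set y | x.2 (g * y)%g]).

(** The factors appear reversed, as for a right action, so precomposing functions with [translate g]
    gives a left action. *)
Lemma translateM g h x : translate (g * h)%g x = translate h (translate g x).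
Proof. by congr pair; apply/seteqP; split=> y /=; rewrite mulgA. Qed.

Lemma translateK g : cancel (translate g) (translate g^-1%g).
Proof.
move=> [n A]; rewrite -translateM mulgV; congr pair.
by apply/seteqP; split=> y /=; rewrite mul1g.
Qed.

Lemma translateVK g : cancel (translate g^-1%g) (translate g).
Proof. by have := translateK g^-1%g; rewrite invgK. Qed.

Lemma translate_bij g : bijective (translate g).
Proof.
by exists (translate g^-1%g); [exact: translateK | exact: translateVK].
Qed.

Lemma translate_ball g n :
  translate g (n, length_ball n) = (n, length_ball n) <-> (l g <= n)%N.
Proof.
(* Forward, evaluating at the identity suffices: it lies in the ball, hence so does [g * 1].
   Backward, the ball is closed under products and inverses. *)
split=> [[/seteqP[_ /(_ 1%g)]]|gn]; rewrite /length_ball /=.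
  by rewrite mulg1 l1; apply.
congr pair; apply/seteqP; split=> h /= hn.
  rewrite -(mulKg g h); apply: leq_trans (lM _ _) _.
  by rewrite geq_max lV gn.
by apply: leq_trans (lM _ _) _; rewrite geq_max gn.
Qed.

Definition ball_indicator (x : nat * set G) : R[i] := (x.2 == length_ball x.1)%:R.

(** The indicator is 1 at infinitely many points, one for each [n], so it is not square summable;
    only this difference is. Being a formal coboundary, it satisfies the cocycle identity by
    telescoping. *)
Definition ball_coboundary (g : G) (x : nat * set G) : R[i] :=
  ball_indicator (translate g x) - ball_indicator x.

(** At level [n] the coboundary is the Dirac mass at [g K_n] minus the one at [K_n]. For [n < l g]
    these points are distinct and the values are 1 and -1; for [n >= l g] they coincide and
    cancel. *)
Lemma normsq_ball_coboundary g x : normsq (ball_coboundary g x) =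
  \sum_(n <- iota 0 (l g)) ((x == translate g^-1%g (n, length_ball n))%:R +
                            (x == (n, length_ball n))%:R).
Proof.
have xE : (x.2 == length_ball x.1) = (x == (x.1, length_ball x.1)).
  by case: x => n A; rewrite xpair_eqE eqxx.
have gxE : ((translate g x).2 == length_ball x.1) =
    (x == translate g^-1%g (x.1, length_ball x.1)).
  rewrite -[RHS](inj_eq (bij_inj (translate_bij g))).
  rewrite translateVK; case: x {xE} => n A /=.
  by rewrite xpair_eqE eqxx.
rewrite /ball_coboundary /ball_indicator /= xE gxE.
(* Only the term whose index is the level of [x] can be nonzero. *)
have off (n : nat) : n != x.1 ->
    (x == translate g^-1%g (n, length_ball n))%:R + (x == (n, length_ball n))%:R = 0 :> R.
  move=> nx; case: x nx {xE gxE} => m A /= nm.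
  by rewrite !xpair_eqE eq_sym (negPf nm) addr0.
have [xlt|lex] := ltnP x.1 (l g).
  rewrite (bigD1_seq x.1) ?mem_iota ?iota_uniq//= big1 ?addr0//.
  have : translate g^-1%g (x.1, length_ball x.1) != (x.1, length_ball x.1).
    by apply/eqP => /translate_ball; rewrite lV leqNgt xlt.
  have [->|_] := eqVneq x (translate g^-1%g _).
    by move=> /negPf ->; rewrite /normsq subr0/= expr1n expr0n.
  by move=> _; case: eqP => _; rewrite /normsq/= ?sub0r ?subrr; ring.
rewrite big1_seq; last first.
  move=> n /=; rewrite mem_iota add0n => /= nl; apply: off.
  by apply: contraTneq nl => ->; rewrite -leqNgt.
have -> : translate g^-1%g (x.1, length_ball x.1) = (x.1, length_ball x.1).
  by apply/translate_ball; rewrite lV.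
by rewrite subrr /normsq/= expr0n addr0.
Qed.

Lemma ball_coboundary_nnsum g :
  abs_summable (fun x => normsq (ball_coboundary g x)) /\
  nnsum (fun x => normsq (ball_coboundary g x)) = (2 * l g)%:R.
Proof.
have -> : (fun x => normsq (ball_coboundary g x)) =
    (fun x => \sum_(n <- iota 0 (l g)) ((x == translate g^-1%g (n, length_ball n))%:R +
                            (x == (n, length_ball n))%:R)).
  by apply/funext => x; exact: normsq_ball_coboundary.
have := @nnsum_sum_deltas R _ _ (iota 0 (l g))
  (fun n => translate g^-1%g (n, length_ball n)) (fun n => (n, length_ball n)).
by rewrite size_iota.
Qed.

Lemma ball_coboundary_square_summable g :
  ball_coboundary g \in @square_summable R (nat * set G)%type.
Proof. by apply/square_summableP; have [] := ball_coboundary_nnsum g. Qed.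

Let H := ell2_hilbert R (nat * set G)%type.

Definition ball_cocycle (g : G) : H := Ell2 (ball_coboundary_square_summable g).

Definition translation_rep (g : G) : {linear H -> H} := ell2_comp (translate_bij g).

Lemma translation_rep_unitary : unitary_representation translation_rep.
Proof.
split=> [g|g h u]; first exact: ell2_comp_unitary.
by apply: ell2_eq => x; rewrite /= translateM.
Qed.

Lemma ball_cocycleP : cocycle translation_rep ball_cocycle.
Proof.
move=> g h; apply: ell2_eq => x; rewrite ell2DE /= /ball_coboundary translateM.
by rewrite addrA subrK.
Qed.

Lemma norm_ball_cocycle g : `|ball_cocycle g| = (Num.sqrt (2 * l g)%:R)%:C.
Proof. by rewrite ell2_normE; have [_ ->] := ball_coboundary_nnsum g. Qed.

Lemma sup_le1 (A : set R) : (forall x, A x -> x <= 1) -> sup A <= 1.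
Proof.
(* The supremum of the empty set is 0 by convention. *)
move=> A1; have [->|/set0P A0] := eqVneq A set0; first by rewrite sup0.
by apply: ge_sup => // x /A1.
Qed.

Theorem ultrametric_compression :
  2^-1 <= equivariant_compression (fun g => (l g)%:R : R).
Proof.
pose len g : R := (l g)%:R.
(* Take [C = D = 1]. The lower bound is [sqrt l <= sqrt (2 l)], and the upper one follows from
   [2 l <= (l + 1) ^ 2]. *)
have bounds g : (1^-1 * len g `^ 2^-1 - 1)%:C <= `|ball_cocycle g|
    <= (1 * len g + 1)%:C.
  rewrite norm_ball_cocycle !lecR invr1 !mul1r powR12_sqrt ?ler0n//.
  rewrite natrM lerBlDr; apply/andP; split.
    apply: (@le_trans _ _ (Num.sqrt (2 * (l g)%:R))); last by rewrite lerDl.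
    by rewrite ler_wsqrtr// ler_peMl// ler1n.
  have l0 : 0 <= len g by rewrite ler0n.
  rewrite -(ler_sqr) ?nnegrE ?sqrtr_ge0 ?addr_ge0// sqr_sqrtr ?mulr_ge0//.
  by rewrite -/(len g) sqrrD; nra.
have half : compression_exponents len ball_cocycle 2^-1.
  split; first by apply/andP; split; lra.
  by exists 1, 1; split.
(* Both suprema must be over sets bounded above before a member can be compared with them; 1 bounds
   each. *)
have exp_le1 (K : hilbertType R) (b : G -> K) c :
    compression_exponents len b c -> c <= 1 by case=> /andP[].
apply: (@le_trans _ _ (compression len ball_cocycle)).
  by apply: ub_le_sup half; exists 1 => c; exact: exp_le1.
apply: ub_le_sup.
  exists 1 => _ [K [pi [b [_ _ _ ->]]]]; apply: sup_le1 => c; exact: exp_le1.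
exists H, translation_rep, ball_cocycle; split=> //.
- exact: translation_rep_unitary.
- exact: ball_cocycleP.
- exists 1, 1; split=> // g; by have /andP[] := bounds g.
Qed.

End UltrametricLength.

(** * The length on the direct sum is ultrametric *)

Section DirectSumLength.
Variable F : nat -> finGroupType.
Implicit Types g h : dsum F.

Lemma dsum_length1 : dsum_length (1%g : dsum F) = 0%N.
Proof. by apply/eqP; rewrite -leqn0; apply/dsum_lengthP. Qed.

Lemma dsum_lengthV_le g : (dsum_length g^-1%g <= dsum_length g)%N.
Proof.
have /dsum_lengthP gP := leqnn (dsum_length g).
by apply/dsum_lengthP => i /gP gi; rewrite /= gi invg1.
Qed.

Lemma dsum_lengthV g : dsum_length g^-1%g = dsum_length g.
Proof.
apply/eqP; rewrite eqn_leq dsum_lengthV_le /=.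
by rewrite -{1}(invgK g) dsum_lengthV_le.
Qed.

(** Products are computed coordinatewise, so a coordinate beyond both lengths is trivial in the
    product. *)
Lemma dsum_lengthM g h :
  (dsum_length (g * h)%g <= maxn (dsum_length g) (dsum_length h))%N.
Proof.
have /dsum_lengthP gP := leqnn (dsum_length g).
have /dsum_lengthP hP := leqnn (dsum_length h).
by apply/dsum_lengthP => i; rewrite gtn_max => /andP[/gP gi /hP hi];
  rewrite /= gi hi mulg1.
Qed.

End DirectSumLength.

Theorem theorem1p6 (R : realType) (F : nat -> finGroupType)
    (F0 : forall x : F 0%N, x = 1%g) :
  3^-1 <= equivariant_compression
            (fun g : dsum F => (dsum_length g)%:R : R).
Proof.
apply: (@le_trans _ _ 2^-1); first by rewrite lef_pV2 ?posrE// ler_nat.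
apply: ultrametric_compression.
- exact: dsum_length1.
- exact: dsum_lengthV.
- exact: dsum_lengthM.
Qed.
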